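(* Let $m,n\ge 1$ be integers and let $p_1,\dots,p_m\in[0,1]$. Let $\omega=\frac1m\sum_{j=1}^m \lambda_j$, where each $\lambda_j$ is a Bernoulli random variable with success probability $P(\lambda_j=1)=p_j$. Let $\omega_1,\dots,\omega_n$ be independent and identically distributed random variables, each with the distribution of $\omega$, and let $\bar\omega=\frac1n\sum_{i=1}^n\omega_i$. Put $\bar\sigma^2=\frac1m\sum_{j=1}^m p_j(1-p_j)$. Then for any $\epsilon>0$, $$P\big(|\bar\omega-\mathbb{E}[\bar\omega]|\ge\epsilon\big)\le 2\exp\left(\frac{-n\epsilon^2/2}{\bar\sigma^2/m+\epsilon/3}\right).$$
   Context: Interpretation: in a nonlocal game, players who cannot communicate answer a referee's questions, and a rule function decides whether the answers win (value 1) or lose (value 0). There are $m$ possible questions $q_1,\dots,q_m$, and a round consists of the referee asking the players all $m$ questions once and checking their answers. The random variable $\lambda_j\in\{0,1\}$ is the outcome on question $q_j$, $p_j$ is the (unknown) win rate of question $q_j$, $\omega$ is the game value of a single round, $n$ is the number of rounds, and $\bar\omega$ is the empirical estimate of the game win rate after $n$ rounds.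
   Formalization: The outcomes λ_1,…,λ_m are assumed mutually independent, which the text does not say; without this the bound fails, e.g. all λ_j equal to one fair coin, n=1, ε=1/2, m≥20. *)

(* Defs.v *)
From HB Require Import structures.
From mathcomp Require Import all_boot all_order all_algebra.
From mathcomp Require Import all_classical all_reals all_analysis.

Set Implicit Arguments.
Unset Strict Implicit.
Unset Printing Implicit Defensive.

Import Order.TTheory GRing.Theory Num.Theory.
Import numFieldNormedType.Exports.

Local Open Scope classical_set_scope.
Local Open Scope ring_scope.

Section definitions.
Context {R : realType} d (T : measurableType d) (P : probability T R).

Definition mutually_independent d' (T' : measurableType d') (I : finType)
    (X : I -> {RV P >-> T'}) : Prop :=
  forall (J : {set I}) (A : I -> set T'),
    (forall i, i \in J -> measurable (A i)) ->
    P (\bigcap_(i in [set i | i \in J]) (X i @^-1` A i)) =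
      (\prod_(i in J) P (X i @^-1` A i))%E.

(* Only measurable sets are compared: the value of a library measure on a
   nonmeasurable set carries no meaning. *)
Definition bernoulli_RV (X : {RV P >-> R}) (p : R) : Prop :=
  forall A : set R, measurable A ->
    distribution P X A =
      pushforward (bernoulli_prob p) (fun b : bool => b%:R : R) A.

Definition mean_RV (n : nat) (X : 'I_n -> {mfun T >-> R}) : T -> R :=
  fun t => (\sum_(i < n) X i t) / n%:R.

Lemma measurable_mean_RV (n : nat) (X : 'I_n -> {mfun T >-> R}) :
  measurable_fun [set: T] (mean_RV X).
Proof.
apply: (measurableT_comp (measurable_realfun.mulrr_measurable _)).
by apply: measurable_sum => i; exact: measurable_funPT.
Qed.

HB.instance Definition _ (n : nat) (X : 'I_n -> {mfun T >-> R}) :=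
  isMeasurableFun.Build _ _ _ _ (mean_RV X) (measurable_mean_RV X).

End definitions.
Arguments mutually_independent {R d T} P {d' T' I} X.
Arguments bernoulli_RV {R d T} P X p.

Definition identically_distributed (R : realType) d d' d''
    (T : measurableType d) (T' : measurableType d') (S : measurableType d'')
    (P : probability T R) (Q : probability T' R)
    (X : {RV P >-> S}) (Y : {RV Q >-> S}) : Prop :=
  forall A : set S, measurable A -> distribution P X A = distribution Q Y A.
Arguments identically_distributed {R d d' d'' T T' S} P Q X Y.

(* Main.v *)
(** Chernoff's method. By independence the moment generating function of
    [omega - E omega] at [s] is the product over [j] of those of
    [(lambda_j - p_j) / m], and each of these is at most
    [exp (p_j (1 - p_j) (s/m)^2 / (2 (1 - |s|/3)))] because
    [exp x <= 1 + x + x^2 / (2 (1 - a/3))] for [|x| <= a < 3]: compare the tail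
    of the exponential series with a geometric one, using [(k+2)! >= 2 * 3^k].
    Markov's inequality for the [n] independent rounds, with
    [s = eps / (v + eps/3)] and [v] the variance of [omega], bounds each of the
    two tails. *)
Require Import Defs.
From HB Require Import structures.
From mathcomp Require Import all_boot all_order all_algebra.
From mathcomp Require Import all_classical all_reals all_analysis.
From mathcomp Require Import measurable_realfun.
From mathcomp Require Import ring lra.

Set Implicit Arguments.
Unset Strict Implicit.
Unset Printing Implicit Defensive.

Import Order.TTheory GRing.Theory Num.Theory.
Import numFieldNormedType.Exports.

Local Open Scope classical_set_scope.
Local Open Scope ring_scope.

(** * Quadratic bounds on the exponential and on a Bernoulli moment generating function *)

Lemma fact_ge_2mul3X (k : nat) : (2 * 3 ^ k <= k.+2`!)%N.
Proof.
elim: k => [//|k IHk].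
by rewrite factS expnS mulnCA leq_mul.
Qed.

Lemma expR_le_quadratic (R : realType) (x a : R) : `|x| <= a -> a < 3 ->
  expR x <= 1 + x + x ^+ 2 / (2 * (1 - a / 3)).
Proof.
move=> xa a3; have a0 : 0 <= a := le_trans (normr_ge0 x) xa.
(* Setting [x = 0] apart gives [0 < a]: the comparison with the limit of a geometric series needs a
   positive ratio [a / 3]. *)
have [x0|x0] := eqVneq x 0.
  by rewrite x0 expR0 expr0n/= mul0r !addr0.
have {}a0 : 0 < a by rewrite (lt_le_trans _ xa)// normr_gt0.
rewrite /expR; apply: limr_le; first exact: is_cvg_series_exp_coeff.
(* Only partial sums of at least two terms matter for the limit: degrees 0 and 1 give [1 + x], and
   the other [k] terms face the geometric series with first term [x ^+ 2 / 2]. *)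
exists 2%N => // -[|[|k]]//= _.
rewrite /series/= big_nat_recl// big_nat_recl//= /exp_coeff/=.
rewrite expr0 !fact0 divr1 expr1 divr1 -addrA lerD2l lerD2l.
apply: (@le_trans _ _ (series (geometric (x ^+ 2 / 2) (a / 3)) k)).
  rewrite /series/=; apply: ler_sum => i _.
  rewrite (_ : x ^+ i.+2 / _ = x ^+ 2 * (x ^+ i / i.+2`!%:R)); last first.
    by rewrite -addn2 exprD; ring.
  rewrite /geometric/= -[leRHS]mulrA ler_wpM2l ?sqr_ge0//.
  rewrite (_ : 2^-1 * _ = a ^+ i / (2 * 3 ^ i)%:R); last first.
    by rewrite natrM natrX invfM expr_div_n; ring.
  apply: (@le_trans _ _ (a ^+ i / i.+2`!%:R)).
    rewrite ler_wpM2r ?invr_ge0// (le_trans (ler_norm _))// normrX.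
    by rewrite lerXn2r// nnegrE ltW.
  rewrite ler_wpM2l ?(exprn_ge0 _ (ltW a0))// lef_pV2 ?posrE ?ltr0n ?fact_gt0//.
    by rewrite ler_nat fact_ge_2mul3X.
  by rewrite muln_gt0 expn_gt0.
rewrite [leRHS](_ : _ = x ^+ 2 / 2 * (1 - a / 3)^-1); last first.
  by rewrite invfM mulrA.
apply: geometric_le_lim; rewrite ?divr_ge0 ?sqr_ge0 ?divr_gt0//.
by rewrite ger0_norm ?divr_ge0 ?ltW// ltr_pdivrMr// mul1r.
Qed.

(** Both exponents are at most [|c|] in absolute value, so the quadratic bound applies with [a]
    equal to [|c|]. On averaging, the linear terms cancel since the variable is centered, and the
    squares add up to the variance [p * (1 - p)] times [c ^+ 2]; then [1 + y <= expR y]. *)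
Lemma centered_bernoulli_mgf_le (R : realType) (p c : R) : 0 <= p <= 1 ->
    `|c| < 3 ->
  p * expR (c * (1 - p)) + (1 - p) * expR (c * (0 - p)) <=
  expR (p * (1 - p) * (c ^+ 2 / (2 * (1 - `|c| / 3)))).
Proof.
move=> /andP[p0 p1] c3; apply: le_trans (expR_ge1Dx _).
have q0 : 0 <= 1 - p by rewrite subr_ge0.
have /expR_le_quadratic/(_ c3) le1 : `|c * (1 - p)| <= `|c|.
  by rewrite normrM ler_piMr// ger0_norm// gerBl.
have /expR_le_quadratic/(_ c3) le0 : `|c * (0 - p)| <= `|c|.
  by rewrite normrM ler_piMr// add0r normrN ger0_norm.
rewrite (le_trans (lerD (ler_wpM2l p0 le1) (ler_wpM2l q0 le0)))//.
by rewrite le_eqVlt; apply/orP; left; apply/eqP; ring.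
Qed.

(** * Integral of a product of functions of independent random variables *)

Section independence.
Context (R : realType) d (T : measurableType d) (P : probability T R).
Context d' (T' : measurableType d').

Import HBNNSimple.

(* Approximation of [g] by simple functions reduces the claim to indicators. *)
Lemma ge0_integralM_indep (W : T -> R) (X : {RV P >-> T'}) (g : T' -> R) :
    measurable_fun [set: T] W -> (forall t, 0 <= W t) ->
    (\int[P]_t (W t)%:E \is a fin_num)%E ->
    (forall A, measurable A ->
      \int[P]_t (W t * \1_A (X t))%:E = \int[P]_t (W t)%:E * P (X @^-1` A))%E ->
    measurable_fun [set: T'] g -> (forall x, 0 <= g x) ->
  (\int[P]_t (W t * g (X t))%:E =
   \int[P]_t (W t)%:E * \int[P]_t (g (X t))%:E)%E.
Proof.
move=> mW W0 finW indep mg g0.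
have mEg : measurable_fun [set: T'] (EFin \o g) by exact/measurable_EFinP.
pose h := nnsfun_approx measurableT mEg.
have cvh x : (h n x)%:E @[n --> \oo] --> (g x)%:E.
  exact: (cvg_nnsfun_approx measurableT mEg (fun x _ => g0 x)).
have ndh t : nondecreasing_seq (fun n => h n (X t)).
  by move=> m n /(nd_nnsfun_approx measurableT mEg)/lefP.
have mhX n : measurable_fun [set: T] (fun t => h n (X t)).
  exact: measurableT_comp.
have mIX A : measurable A -> measurable_fun [set: T] (fun t => \1_A (X t) : R).
  by move=> mA; apply: measurableT_comp => //; exact: measurable_indic.
have mh n y : measurable (h n @^-1` [set y]) by exact: measurable_sfunP.
(* Expansion of [h n] over its finite range, needed for [V = W] and for [V = 1]. Writing [|y|] for
   [y] changes nothing on the range, where values are nonnegative, and keeps every term of the sum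
   nonnegative. *)
have decomp (V : T -> R) (n : nat) :
    measurable_fun [set: T] V -> (forall t, 0 <= V t) ->
    (\int[P]_t (V t * h n (X t))%:E =
     \sum_(y \in range (h n))
       `|y|%:E * \int[P]_t (V t * \1_(h n @^-1` [set y]) (X t))%:E)%E.
  move=> mV V0; have mVI y :
      measurable_fun [set: T] (fun t => V t * \1_(h n @^-1` [set y]) (X t)).
    by apply: measurable_funM => //; exact: mIX.
  have VI0 y t : 0 <= V t * \1_(h n @^-1` [set y]) (X t) by rewrite mulr_ge0.
  under [RHS]eq_fsbigr => y _.
    rewrite -ge0_integralZl_EFin//; first last.
    + exact/measurable_EFinP.
    + by move=> t _; rewrite lee_fin.
    over.
  rewrite -ge0_integral_fsum//; first last.
  - by move=> y t _; rewrite -EFinM lee_fin mulr_ge0.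
  - by move=> y; apply/measurable_EFinP; exact: measurable_funM.
  apply: eq_integral => t _; rewrite fimfunE fsumEFin//; congr EFin.
  rewrite mulr_fsumr//; apply: eq_fsbigr => _ /set_mem [x _ <-].
  by rewrite ger0_norm// mulrCA.
have simple n : (\int[P]_t (W t * h n (X t))%:E =
    \int[P]_t (W t)%:E * \int[P]_t (h n (X t))%:E)%E.
  have -> : (\int[P]_t (h n (X t))%:E = \int[P]_t (cst 1 t * h n (X t))%:E)%E.
    by under [RHS]eq_integral do rewrite mul1r.
  rewrite !decomp// ge0_mule_fsumr//; last first.
    move=> y; rewrite mule_ge0 ?integral_ge0// => t _.
    by rewrite lee_fin mulr_ge0.
  apply: eq_fsbigr => y _; rewrite indep// muleCA; congr (_ * (_ * _))%E.
  under eq_integral do rewrite mul1r.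
  by rewrite -[in LHS](setIT (X @^-1` _)) -integral_indic//;
    exact: measurable_funPTI.
have mono (V : T -> R) : measurable_fun [set: T] V -> (forall t, 0 <= V t) ->
    (\int[P]_t (V t * h n (X t))%:E @[n --> \oo] -->
     \int[P]_t (V t * g (X t))%:E)%E.
  move=> mV V0.
  have -> : (\int[P]_t (V t * g (X t))%:E =
      \int[P]_t limn (fun n => (V t * h n (X t))%:E))%E.
    apply: eq_integral => t _; apply/esym/cvg_lim => //.
    by under eq_fun do rewrite EFinM; rewrite EFinM; exact: cvgeZl.
  apply: cvg_monotone_convergence => //.
  - by move=> n; apply/measurable_EFinP; exact: measurable_funM.
  - by move=> n t _; rewrite lee_fin mulr_ge0.
  - by move=> t _ m n mn; rewrite lee_fin ler_wpM2l// ndh.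
have cvh1 : (\int[P]_t (h n (X t))%:E @[n --> \oo] -->
    \int[P]_t (g (X t))%:E)%E.
  have := mono (cst 1) (measurable_cst _) (fun=> ler01).
  under eq_fun do under eq_integral do rewrite mul1r.
  by under eq_integral do rewrite mul1r.
(* Finiteness of the integral of [W] makes multiplication by it continuous, so both sides of
   [simple] converge and the limits agree. *)
have := cvgeZl finW cvh1; under eq_fun do rewrite -simple.
by move=> /(cvg_unique (@ereal_hausdorff R))/(_ (mono W mW W0)).
Qed.

(* The factors are freed from being indicators one index at a time: [h i] is
   arbitrary for [i] in [s]. *)
Lemma integral_prod_indep_seq (I : finType) (X : I -> {RV P >-> T'})
    (s : seq I) (h : I -> T' -> R) :
    mutually_independent P X ->
    (forall i, measurable_fun [set: T'] (h i)) -> (forall i x, 0 <= h i x) ->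
    (forall i, \int[P]_t (h i (X i t))%:E < +oo)%E ->
    (forall i, i \notin s -> exists2 A, measurable A & h i = \1_A) ->
  (\int[P]_t (\prod_i h i (X i t))%:E = \prod_i \int[P]_t (h i (X i t))%:E)%E.
Proof.
move=> indep; elim: s h => [|k s IHs] h mh h0 hoo hs.
  (* With [s] empty every factor is an indicator; their product is the indicator of an intersection,
     and the definition of independence applies to the full index set. *)
  have {hs}/choice[A hA] : forall i, exists A, measurable A /\ h i = \1_A.
    by move=> i; have [//|A mA ->] := hs i; exists A.
  pose B i := X i @^-1` A i.
  have mB i : measurable (B i) by apply: measurable_funPTI; exact: (hA i).1.
  have hB i : (fun t => h i (X i t)) = \1_(B i) by rewrite (hA i).2.
  have prodB t : \prod_i h i (X i t) =
      \1_(\bigcap_(i in [set i | i \in [set: I]%SET]) B i) t.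
    have {1}-> : \prod_i h i (X i t) = \prod_i \1_(B i) t.
      by apply: eq_bigr => i _; rewrite -hB.
    rewrite indicE; have [inB|/negP] := boolP (t \in _).
      rewrite big1// => i _; rewrite indicE mem_set//.
      by apply: (set_mem inB) => /=; rewrite inE.
    rewrite inE => /existsNP[i /not_implyP[_ Bi]].
    by rewrite (bigD1 i)//= indicE memNset ?mul0r.
  under eq_integral do rewrite prodB.
  rewrite integral_indic//; last first.
    by apply: fin_bigcap_measurable.
  rewrite setIT; apply: etrans (indep [set: I]%SET A _) _.
    by move=> i _; exact: (hA i).1.
  apply: eq_big => [i|i _]; first by rewrite inE.
  by rewrite -[LHS]/(P (B i)) -[in LHS](setIT (B i)) -integral_indic// -hB.
(* Replacing the factor at [k] by an indicator brings the family under the induction hypothesis.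
   This shows that the product [W] of the other factors satisfies the product formula against
   indicators of [X k]. *)
pose h' A i := if i == k then \1_A else h i.
have h'k A : h' A k = \1_A by rewrite /h' eqxx.
have h'E A i : i != k -> h' A i = h i by rewrite /h' => /negbTE ->.
pose W t := \prod_(i | i != k) h i (X i t).
pose c := (\prod_(i | i != k) \int[P]_t (h i (X i t))%:E)%E.
have IX A : measurable A -> (\int[P]_t (\1_A (X k t))%:E = P (X k @^-1` A))%E.
  move=> mA; rewrite -[in RHS](setIT (X k @^-1` _)) -integral_indic//.
  exact: measurable_funPTI.
have WI A : measurable A -> (\int[P]_t (W t * \1_A (X k t))%:E =
    c * P (X k @^-1` A))%E.
  move=> mA.
  transitivity (\int[P]_t (\prod_i h' A i (X i t))%:E)%E.
    apply: eq_integral => t _; rewrite (bigD1 k)//= h'k mulrC; congr (_ * _)%:E.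
    by apply: eq_bigr => i ik; rewrite h'E.
  rewrite IHs.
  - rewrite (bigD1 k)//= h'k IX// muleC; congr (_ * _)%E.
    by apply: eq_bigr => i ik; rewrite h'E.
  - move=> i; rewrite /h'; case: ifP => // _; exact: measurable_indic.
  - by move=> i x; rewrite /h'; case: ifP.
  - move=> i; have [->|ik] := eqVneq i k; last by rewrite h'E.
    rewrite h'k IX// (@le_lt_trans _ _ 1%E) ?ltry// probability_le1//.
    exact: measurable_funPTI.
  - move=> i si; have [->|ik] := eqVneq i k; first by rewrite h'k; exists A.
    by rewrite h'E//; apply: hs; rewrite inE negb_or ik.
(* The case of [WI] where [A] is the whole space. *)
have cE : (\int[P]_t (W t)%:E = c)%E.
  have := WI _ measurableT; rewrite preimage_setT probability_setT mule1 => <-.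
  by under [RHS]eq_integral do rewrite indicT mulr1.
rewrite (bigD1 k)//= muleC -/c -cE.
under eq_integral do rewrite (bigD1 k)//= mulrC.
apply: ge0_integralM_indep => //.
- rewrite /W; under eq_fun do rewrite -big_filter.
  by apply: measurable_prod => i _; apply: measurableT_comp.
- by move=> t; apply: prodr_ge0.
- rewrite cE; apply: prode_fin_num => i _.
  by rewrite ge0_fin_numE// integral_ge0// => t _; rewrite lee_fin.
- by move=> A mA; rewrite cE WI.
Qed.

Lemma integral_prod_indep (I : finType) (X : I -> {RV P >-> T'})
    (h : I -> T' -> R) :
    mutually_independent P X ->
    (forall i, measurable_fun [set: T'] (h i)) -> (forall i x, 0 <= h i x) ->
    (forall i, \int[P]_t (h i (X i t))%:E < +oo)%E ->
  (\int[P]_t (\prod_i h i (X i t))%:E = \prod_i \int[P]_t (h i (X i t))%:E)%E.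
Proof.
move=> indep mh h0 hoo.
(* When all indices are listed, the condition on indicators is vacuous. *)
apply: (@integral_prod_indep_seq _ _ (enum I)) => // i.
by rewrite mem_enum.
Qed.

End independence.

(** * Transfer of integrals between variables with the same law *)

Section same_law.
Context (R : realType) d d' d'' (T : measurableType d) (T' : measurableType d')
  (S : measurableType d'') (P : probability T R) (Q : probability T' R)
  (X : {RV P >-> S}) (Y : {RV Q >-> S}).

Lemma ge0_integral_same_law (g : S -> \bar R) :
    identically_distributed P Q X Y ->
    measurable_fun [set: S] g -> (forall x, 0 <= g x)%E ->
  (\int[P]_t g (X t) = \int[Q]_t g (Y t))%E.
Proof.
move=> XY mg g0.
rewrite -[LHS](ge0_integral_distribution X mg g0).
rewrite -[RHS](ge0_integral_distribution Y mg g0).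
by apply: eq_measure_integral => A mA _; exact: XY.
Qed.

Lemma integrable_same_law (g : S -> \bar R) :
    identically_distributed P Q X Y -> measurable_fun [set: S] g ->
    Q.-integrable [set: T'] (g \o Y) ->
  P.-integrable [set: T] (g \o X).
Proof.
move=> XY mg /integrableP[_ gYoo]; apply/integrableP; split.
  exact: measurableT_comp.
rewrite /comp (ge0_integral_same_law (g := abse \o g))//.
- exact: measurableT_comp.
- by move=> x; exact: abse_ge0.
Qed.

Lemma integral_same_law (g : S -> \bar R) :
    identically_distributed P Q X Y -> measurable_fun [set: S] g ->
    Q.-integrable [set: T'] (g \o Y) ->
  (\int[P]_t g (X t) = \int[Q]_t g (Y t))%E.
Proof.
move=> XY mg gY.
have gX := integrable_same_law XY mg gY.
rewrite -[LHS](integral_distribution (X := X) mg gX).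
rewrite -[RHS](integral_distribution (X := Y) mg gY).
by apply: eq_measure_integral => A mA _; exact: XY.
Qed.

End same_law.

(** * Integrals of functions of a Bernoulli variable *)

Section bernoulli.
Context (R : realType) d (T : measurableType d) (P : probability T R).

(** Naming the embedding lets it be declared a random variable on the Bernoulli space [bool], so
    that the transfer lemmas apply with that space as the second one. *)
Definition bool_natr (b : bool) : R := b%:R.

HB.instance Definition _ := isMeasurableFun.Build _ _ _ _ bool_natr
  (fun _ _ _ => I : measurable (_ : set bool)).

Lemma bernoulli_RV_same_law (X : {RV P >-> R}) (p : R) :
  bernoulli_RV P X p ->
  identically_distributed P (bernoulli_prob p) X (bool_natr : {RV _ >-> R}).
Proof. by []. Qed.

Lemma ge0_integral_bernoulli_RV (X : {RV P >-> R}) (p : R) (g : R -> R) :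
    0 <= p <= 1 -> bernoulli_RV P X p ->
    measurable_fun [set: R] g -> (forall x, 0 <= g x) ->
  (\int[P]_t (g (X t))%:E = (p * g 1 + (1 - p) * g 0)%:E)%E.
Proof.
move=> p01 /bernoulli_RV_same_law XB mg g0.
rewrite (ge0_integral_same_law (g := EFin \o g) XB)//; last first.
  exact/measurable_EFinP.
by rewrite integral_bernoulli_prob// => b; rewrite lee_fin.
Qed.

Lemma integrable_bernoulli_RV (X : {RV P >-> R}) (p : R) :
    0 <= p <= 1 -> bernoulli_RV P X p ->
  P.-integrable [set: T] (EFin \o X).
Proof.
move=> p01 XB; apply/integrableP; split; first exact/measurable_EFinP.
under eq_integral do rewrite /= -/(`|X _|%:E).
by rewrite (ge0_integral_bernoulli_RV (g := Num.norm) p01 XB)// ltry.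
Qed.

Lemma expectation_bernoulli_RV (X : {RV P >-> R}) (p : R) :
    0 <= p <= 1 -> bernoulli_RV P X p ->
  ('E_P[X] = p%:E)%E.
Proof.
move=> p01 XB; rewrite unlock.
have {}XB := bernoulli_RV_same_law XB.
rewrite (integral_same_law (g := EFin) XB)//; first last.
  apply/integrableP; split; first exact/measurable_EFinP.
  by rewrite integral_bernoulli_prob//= ltry.
rewrite integral_bernoulli_prob => [||b] //; last by rewrite lee_fin.
by rewrite /bool_natr/= mule1 mule0 adde0.
Qed.

End bernoulli.

(** * Integrability and expectation of an empirical mean *)

Section mean.
Context (R : realType) d (T : measurableType d) (P : probability T R).

Lemma EFin_mean_RV n (X : 'I_n -> {mfun T >-> R}) :
  EFin \o mean_RV X = (fun t => n%:R^-1%:E * \sum_i (X i t)%:E)%E.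
Proof. by apply/funext => t; rewrite /= /mean_RV mulrC EFinM sumEFin. Qed.

Lemma integrable_sumE n (X : 'I_n -> {RV P >-> R}) :
    (forall i, P.-integrable [set: T] (EFin \o X i)) ->
  P.-integrable [set: T] (fun t => \sum_i (X i t)%:E)%E.
Proof.
move=> iX; apply: (@integrable_sum _ _ _ P _ measurableT _ _ predT
  (fun i => EFin \o X i)) => i _; exact: iX.
Qed.

Lemma integrable_mean_RV n (X : 'I_n -> {RV P >-> R}) :
    (forall i, P.-integrable [set: T] (EFin \o X i)) ->
  P.-integrable [set: T] (EFin \o mean_RV X).
Proof.
move=> iX; rewrite EFin_mean_RV.
by apply: integrableZl => //; exact: integrable_sumE.
Qed.

Lemma expectation_mean_RV n (X : 'I_n -> {RV P >-> R}) :
    (forall i, P.-integrable [set: T] (EFin \o X i)) ->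
  ('E_P[mean_RV X] = n%:R^-1%:E * \sum_i 'E_P[X i])%E.
Proof.
move=> iX; rewrite unlock.
rewrite -[LHS]/(\int[P]_t (EFin \o mean_RV X) t)%E EFin_mean_RV.
rewrite integralZl//; last exact: integrable_sumE.
congr (_ * _)%E; exact: (integral_sum measurableT (f := fun i => EFin \o X i)).
Qed.

End mean.

(** * Exponential moments of independent sums and Chernoff's bound *)

Lemma measurable_expR_affine (R : realType) (c a : R) :
  measurable_fun [set: R] (fun x => expR (c * (x - a))).
Proof.
apply: measurableT_comp => //; apply: measurable_funM => //.
exact: measurable_funB.
Qed.

Section chernoff.
Context (R : realType) d (T : measurableType d) (P : probability T R).

Lemma integral_expR_sum_indep n (X : 'I_n -> {RV P >-> R}) (c : R)
    (a : 'I_n -> R) :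
    mutually_independent P X ->
    (forall i, \int[P]_t (expR (c * (X i t - a i)))%:E < +oo)%E ->
  (\int[P]_t (expR (c * \sum_i (X i t - a i)))%:E =
   \prod_i \int[P]_t (expR (c * (X i t - a i)))%:E)%E.
Proof.
move=> indep fin.
rewrite -(integral_prod_indep (h := fun i (x : R) => expR (c * (x - a i)))) //.
- by apply: eq_integral => t _; rewrite mulr_sumr expR_sum.
- by move=> i; exact: measurable_expR_affine.
Qed.

(** On the event, the sum of the [X i t - a] multiplied by [s] is at least [n%:R * b]; Markov's
    inequality for its exponential gives the bound. The sign of [s] is free, so upper and lower
    tails are both covered. *)
Lemma chernoff_mean_RV n (X : 'I_n -> {RV P >-> R}) (s a b K : R) :
    (0 < n)%N -> mutually_independent P X ->
    (forall i, \int[P]_t (expR (s * (X i t - a)))%:E <= (expR K)%:E)%E ->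
  (P [set t | b <= s * (mean_RV X t - a)]%R <= (expR (n%:R * (K - b)))%:E)%E.
Proof.
move=> n0 indep mgf; set A := [set t | _].
have nR : n%:R != 0 :> R by rewrite pnatr_eq0 -lt0n.
have mY : measurable_fun [set: T] (fun t => expR (s * \sum_i (X i t - a))).
  apply: measurableT_comp => //; apply: measurable_funM => //.
  by apply: measurable_sum => i; exact: measurable_funB.
have mA : measurable A.
  rewrite /A -[X in measurable X]setTI.
  apply: measurable_fun_le => //; apply: measurable_funM => //.
  apply: measurable_funB => //; exact: measurable_mean_RV.
(* Markov's inequality in pointwise form: the indicator of [A] is at most the integrand, which is at
   least 1 on [A] and positive elsewhere. *)
apply: (@le_trans _ _
    (\int[P]_t ((expR (- (n%:R * b)))%:E *
                 (expR (s * \sum_i (X i t - a)))%:E))%E).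
  rewrite -(setIT A) -integral_indic//; apply: ge0_le_integral => //.
  - exact/measurable_EFinP/measurable_indic.
  - by apply/measurable_EFinP; exact: measurable_funM.
  move=> t _; rewrite -EFinM lee_fin -expRD indicE.
  have [/set_mem At|_] := boolP (t \in A); last by rewrite expR_ge0.
  rewrite -[leLHS]expR0 ler_expR addrC subr_ge0.
  have -> : \sum_i (X i t - a) = n%:R * (mean_RV X t - a).
    by rewrite sumrB sumr_const card_ord /mean_RV -mulr_natl; field.
  by rewrite mulrCA ler_wpM2l.
rewrite ge0_integralZl_EFin//; last exact/measurable_EFinP.
rewrite integral_expR_sum_indep//; last first.
  by move=> i; rewrite (le_lt_trans (mgf i))// ltry.
rewrite mulrBr addrC expRD EFinM lee_pmul2l// ?lte_fin ?expR_gt0//.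
have -> : n%:R * K = \sum_(i < n) K by rewrite sumr_const card_ord mulr_natl.
rewrite expR_sum -prodEFin.
(* Inequalities in [\bar R] multiply only between nonnegative terms, so nonnegativity is carried
   along the product. *)
pose le0 (x y : \bar R) := (0 <= x)%E /\ (x <= y)%E.
suff [] : le0 (\prod_(i < n) \int[P]_t (expR (s * (X i t - a)))%:E)%E
    (\prod_(i < n) (expR K)%:E)%E by [].
apply: (big_ind2 le0) => [|x1 x2 y1 y2 [? ?] [? ?]|i _].
- by split.
- by split; [exact: mule_ge0|exact: lee_pmul].
- by split; [apply: integral_ge0 => t _; rewrite lee_fin expR_ge0|exact: mgf].
Qed.

End chernoff.

(** * The moment generating function of one round, and the two-sided bound *)

Lemma mgf_mean_bernoulli_le (R : realType) d (T : measurableType d)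
    (P : probability T R) m (lambda : 'I_m -> {RV P >-> R}) (p : 'I_m -> R)
    (s : R) :
    (0 < m)%N -> (forall j, 0 <= p j <= 1) ->
    (forall j, bernoulli_RV P (lambda j) (p j)) ->
    mutually_independent P lambda -> `|s| < 3 ->
  (\int[P]_t (expR (s * (mean_RV lambda t - (\sum_j p j) / m%:R)))%:E <=
   (expR ((\sum_j p j * (1 - p j)) / m%:R / m%:R *
          (s ^+ 2 / (2 * (1 - `|s| / 3)))))%:E)%E.
Proof.
move=> m0 p01 lambdaB indep s3.
have mR : 1 <= m%:R :> R by rewrite ler1n.
have m_neq0 : m%:R != 0 :> R by rewrite pnatr_eq0 -lt0n.
pose c := s / m%:R.
have cs : `|c| <= `|s|.
  rewrite normrM normfV (ger0_norm (ler0n _ _)).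
  by rewrite ler_pdivrMr ?ltr0n// ler_peMr.
have E j : (\int[P]_t (expR (c * (lambda j t - p j)))%:E =
    (p j * expR (c * (1 - p j)) + (1 - p j) * expR (c * (0 - p j)))%:E)%E.
  apply: (ge0_integral_bernoulli_RV (g := fun x => expR (c * (x - p j)))) => //.
  exact: measurable_expR_affine.
have -> : (\int[P]_t (expR (s * (mean_RV lambda t - (\sum_j p j) / m%:R)))%:E =
    \prod_j \int[P]_t (expR (c * (lambda j t - p j)))%:E)%E.
  rewrite -integral_expR_sum_indep//; last by move=> j; rewrite E ltry.
  apply: eq_integral => t _; congr (expR _)%:E.
  by rewrite /mean_RV /c sumrB; field.
under eq_bigr do rewrite E.
rewrite prodEFin lee_fin.
apply: (@le_trans _ _ (\prod_j expR (p j * (1 - p j) *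
    (c ^+ 2 / (2 * (1 - `|c| / 3)))))).
  apply: ler_prod => j _; apply/andP; split.
    have /andP[p0 p1] := p01 j.
    by rewrite addr_ge0// mulr_ge0 ?expR_ge0// subr_ge0.
  by apply: centered_bernoulli_mgf_le; rewrite ?(le_lt_trans cs).
rewrite -expR_sum ler_expR -mulr_suml; set V := \sum_j _.
(* The two divisions by [m%:R] are absorbed in [c ^+ 2]; it remains to compare the denominators,
   using [cs]. *)
rewrite [leRHS](_ : _ = V * (c ^+ 2 / (2 * (1 - `|s| / 3)))); last first.
  by rewrite /c; field; rewrite m_neq0 gt_eqF// subr_gt0.
apply: ler_wpM2l.
  apply: sumr_ge0 => j _; have /andP[p0 p1] := p01 j.
  by rewrite mulr_ge0// subr_ge0.
apply: ler_wpM2l; first exact: sqr_ge0.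
by rewrite lef_pV2 ?posrE; lra.
Qed.

Theorem theorem6p1 (R : realType) (m n : nat) (p : 'I_m -> R)
    (d : measure_display) (T : measurableType d) (P : probability T R)
    (lambda : 'I_m -> {RV P >-> R})
    (d' : measure_display) (T' : measurableType d') (Q : probability T' R)
    (omega_ : 'I_n -> {RV Q >-> R}) (eps : R) :
  (0 < m)%N -> (0 < n)%N ->
  (forall j, 0 <= p j <= 1) ->
  (forall j, bernoulli_RV P (lambda j) (p j)) ->
  mutually_independent P lambda ->
  mutually_independent Q omega_ ->
  (forall i, identically_distributed Q P (omega_ i)
               (mean_RV lambda : {RV P >-> R})) ->
  let omega_bar := mean_RV omega_ in
  let sigma2_bar := (\sum_(j < m) p j * (1 - p j)) / m%:R in
  0 < eps ->
  (Q [set t | (eps <= `|omega_bar t - fine 'E_Q[omega_bar]|)%R ] <=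
     (2 * expR (- (n%:R * eps ^+ 2 / 2) / (sigma2_bar / m%:R + eps / 3)))%:E)%E.
Proof.
move=> m0 n0 p01 lambdaB lambda_indep omega_indep omegaD omega_bar sigma2_bar.
move=> eps0.
have nR : n%:R != 0 :> R by rewrite pnatr_eq0 -lt0n.
pose mu := (\sum_j p j) / m%:R; pose v := sigma2_bar / m%:R.
have v0 : 0 <= v.
  rewrite /v /sigma2_bar !divr_ge0//; apply: sumr_ge0 => j _.
  by have /andP[p0 p1] := p01 j; rewrite mulr_ge0// subr_ge0.
have ilambda j : P.-integrable [set: T] (EFin \o lambda j).
  exact: integrable_bernoulli_RV (p01 j) (lambdaB j).
have imean := integrable_mean_RV ilambda.
have Emean : ('E_P[mean_RV lambda] = mu%:E)%E.
  rewrite expectation_mean_RV//.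
  under eq_bigr do rewrite (expectation_bernoulli_RV (p01 _) (lambdaB _)).
  by rewrite sumEFin -EFinM mulrC.
have mEFin : measurable_fun [set: R] (@EFin R) by exact/measurable_EFinP.
have Eomega i : ('E_Q[omega_ i] = mu%:E)%E.
  by rewrite -Emean unlock (integral_same_law (g := EFin) (omegaD i)).
have iomega i : Q.-integrable [set: T'] (EFin \o omega_ i).
  exact: (integrable_same_law (omegaD i)).
have -> : fine 'E_Q[omega_bar] = mu.
  rewrite expectation_mean_RV//; under eq_bigr do rewrite Eomega.
  by rewrite sumEFin -EFinM/= sumr_const card_ord -[mu *+ n]mulr_natl mulKf.
(* For [s > 0] this is the upper tail, for [s < 0] the lower one. The moment bound for a round is
   carried over from [mean_RV lambda] by equality of laws. *)
have tail (s : R) : `|s| < 3 ->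
    (Q [set t | `|s| * eps <= s * (omega_bar t - mu)]%R <=
    (expR (n%:R * (v * (s ^+ 2 / (2 * (1 - `|s| / 3))) - `|s| * eps)))%:E)%E.
  move=> s3; apply: chernoff_mean_RV => // i.
  rewrite (ge0_integral_same_law (g := fun x : R => (expR (s * (x - mu)))%:E)
    (omegaD i)); last 2 first.
  - by apply/measurable_EFinP; exact: measurable_expR_affine.
  - by move=> x; rewrite lee_fin expR_ge0.
  exact: mgf_mean_bernoulli_le.
have [s /andP[s0 s3] sE] : exists2 s : R, 0 < s < 3 &
    n%:R * (v * (s ^+ 2 / (2 * (1 - s / 3))) - s * eps) <=
    - (n%:R * eps ^+ 2 / 2) / (v + eps / 3).
  (* For [v = 0] the formula for [s] gives [3], where the bound on the moment
     generating function degenerates; any [s] in [[3/2, 3)] will do. *)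
  have [v_eq0|v_neq0] := eqVneq v 0.
    exists (3 / 2); first lra.
    rewrite v_eq0 mul0r !add0r le_eqVlt; apply/orP; left; apply/eqP; field.
    by rewrite gt_eqF.
  have {}v0 : 0 < v by rewrite lt_def v_neq0.
  have D0 : 0 < v + eps / 3 by lra.
  (* With this [s], [1 - s / 3 = v / (v + eps / 3)], so the quadratic term equals [s * eps / 2] and
     the exponent becomes [- n%:R * s * eps / 2], exactly the target. *)
  exists (eps / (v + eps / 3)).
    by rewrite divr_gt0//= ltr_pdivrMr//; lra.
  have -> : 1 - eps / (v + eps / 3) / 3 = v / (v + eps / 3).
    by field; rewrite gt_eqF//; lra.
  rewrite le_eqVlt; apply/orP; left; apply/eqP; field.
  by rewrite v_neq0 gt_eqF//; lra.
set A := [set t | _].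
pose B (r : R) := [set t | `|r| * eps <= r * (omega_bar t - mu)].
have mB r : measurable (B r).
  rewrite /B -[X in measurable X]setTI.
  apply: measurable_fun_le => //; apply: measurable_funM => //.
  apply: measurable_funB => //; exact: measurable_mean_RV.
(* The deviation event is the union of the two tails; subadditivity yields the factor 2. *)
have -> : A = B s `|` B (- s).
  rewrite /A /B normrN gtr0_norm//; apply/seteqP; split => t /=.
    rewrite mulNr -mulrN ler_pM2l// ler_pM2l// ler_normr.
    by move=> /orP.
  by rewrite mulNr -mulrN !ler_pM2l// ler_normr => /orP.
apply: (le_trans (measureU2 _ (mB s) (mB (- s)))).
rewrite (_ : 2 = 1 + 1)// mulrDl mul1r EFinD.
apply: leeD.
  rewrite (le_trans (tail s _)) ?gtr0_norm// lee_fin ler_expR.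
  exact: sE.
rewrite (le_trans (tail (- s) _)) ?normrN ?gtr0_norm// lee_fin ler_expR.
by rewrite sqrrN.
Qed.
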